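(* Let $G$ be a 2-connected bipartite outerplanar graph. Then $G$ is 4-truncated degree-AT, i.e. $G$ has an AT-orientation $D$ such that $d_D^+(v) \le \min\{4, d_G(v)\} - 1$ for every vertex $v$ of $G$.
   Context: Let $D$ be an orientation of a graph $G$. For a subset $H$ of arcs of $D$, $D[H]$ is the subdigraph formed by the arcs of $H$; it is an Eulerian subdigraph if $d^+_{D[H]}(v)=d^-_{D[H]}(v)$ for every vertex $v$ (the empty arc set counts). Let $\mathcal{E}_e(D)$ (resp. $\mathcal{E}_o(D)$) be the set of arc sets $H$ with $D[H]$ Eulerian and $|H|$ even (resp. odd). $D$ is an AT-orientation if $|\mathcal{E}_e(D)| \ne |\mathcal{E}_o(D)|$. For $f: V(G)\to\mathbb{N}$, $G$ is $f$-AT if it has an AT-orientation $D$ with $d_D^+(v)\le f(v)-1$ for every vertex $v$. For a positive integer $k$, $G$ is $k$-truncated degree-AT if $G$ is $f$-AT for $f(v)=\min\{k,d_G(v)\}$. *)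

(* Defs.v *)
From HB Require Import structures.
From mathcomp Require Import all_boot all_order all_algebra.
From mathcomp Require Import all_classical all_reals all_analysis.

Set Implicit Arguments.
Unset Strict Implicit.
Unset Printing Implicit Defensive.

Import Order.TTheory GRing.Theory Num.Theory.
Import numFieldNormedType.Exports.

Record sgraph := SGraph {
  vertex :> finType;
  adj : rel vertex;
  adj_sym : symmetric adj;
  adj_irrefl : irreflexive adj }.

Section Graphs.
Variable G : sgraph.

Definition degree (v : G) : nat := #|[set u | adj v u]|.

Definition bipartite : Prop :=
  exists c : G -> bool, forall x y : G, adj x y -> c x != c y.

Definition adj_off (X : {set G}) : rel G :=
  [rel x y | [&& x \notin X, y \notin X & adj x y]].

(* More than k vertices, and deleting fewer than k of them never disconnects. *)
Definition k_connected (k : nat) : Prop :=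
  (k < #|G|)%N /\
  forall X : {set G}, (#|X| < k)%N ->
  forall x y : G, x \notin X -> y \notin X -> connect (adj_off X) x y.

(* The pair (x, y) is the arc from x to y. *)
Definition outdegree (H : {set G * G}) (v : G) : nat := #|[set u | (v, u) \in H]|.
Definition indegree (H : {set G * G}) (v : G) : nat := #|[set u | (u, v) \in H]|.

Definition orientation (D : {set G * G}) : Prop :=
  (forall x y : G, adj x y = ((x, y) \in D) || ((y, x) \in D)) /\
  (forall x y : G, (x, y) \in D -> (y, x) \notin D).

Definition eulerian (H : {set G * G}) : bool :=
  [forall v, outdegree H v == indegree H v].

Definition even_eulerian (D : {set G * G}) : {set {set G * G}} :=
  [set H : {set G * G} | [&& H \subset D, eulerian H & ~~ odd #|H|]].
Definition odd_eulerian (D : {set G * G}) : {set {set G * G}} :=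
  [set H : {set G * G} | [&& H \subset D, eulerian H & odd #|H|]].

Definition AT_orientation (D : {set G * G}) : Prop :=
  orientation D /\ #|even_eulerian D| <> #|odd_eulerian D|.

(* The bound d^+(v) <= f(v) - 1 is over the integers, hence the strict
   inequality: truncated subtraction would be wrong at f(v) = 0. *)
Definition f_AT (f : G -> nat) : Prop :=
  exists2 D : {set G * G}, AT_orientation D &
    forall v : G, (outdegree D v < f v)%N.

Definition truncated_degree_AT (k : nat) : Prop :=
  f_AT (fun v => minn k (degree v)).

End Graphs.

Local Open Scope classical_set_scope.
Local Open Scope ring_scope.

Section PlaneDrawings.
Variables (R : realType) (G : sgraph).

(* [0, 1] is compact, so a continuous injection is a homeomorphism onto
   its image. *)
Definition simple_arc (p q : R * R) (A : set (R * R)) : Prop :=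
  exists g : R -> R * R,
    [/\ {within `[0, 1], continuous g},
        {in `[0, 1] &, injective g},
        g 0 = p, g 1 = q & A = g @` `[0, 1]].

(* pt x is the point representing the vertex x; for adjacent x and y,
   arc x y is the curve, ends included, representing the edge xy. *)
Record plane_drawing (pt : G -> R * R) (arc : G -> G -> set (R * R)) : Prop :=
  PlaneDrawing {
  drawing_inj : injective pt;
  drawing_sym : forall x y, adj x y -> arc x y = arc y x;
  drawing_arc : forall x y, adj x y -> simple_arc (pt x) (pt y) (arc x y);
  drawing_vertex : forall x y z, adj x y -> arc x y (pt z) -> z = x \/ z = y;
  (* the interior of an edge meets no other edge *)
  drawing_edge : forall x y u v, adj x y -> adj u v ->
    [set x; y]%SET != [set u; v]%SET ->
    forall p, arc x y p -> arc u v p -> p = pt x \/ p = pt y }.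

Definition drawing_support (pt : G -> R * R) (arc : G -> G -> set (R * R)) :
    set (R * R) :=
  [set p | (exists x, p = pt x) \/ (exists x y, adj x y /\ arc x y p)].

Definition is_face (S F : set (R * R)) : Prop :=
  exists2 p, (~` S) p & F = connected_component (~` S) p.

(* The outer face is the unbounded one.  Vertices lie on the drawing, which is
   disjoint from F, so a vertex is in the closure of F if and only if it is on
   the boundary of F. *)
Definition outerplanar : Prop :=
  exists (pt : G -> R * R) (arc : G -> G -> set (R * R)) (F : set (R * R)),
    [/\ plane_drawing pt arc,
        is_face (drawing_support pt arc) F,
        ~ bounded_set F &
        forall x : G, closure F (pt x)].

End PlaneDrawings.

(* Main.v *)
Require Import Defs.
From HB Require Import structures.
From Stdlib Require Import Btauto.
From mathcomp Require Import all_boot all_order all_algebra.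
From mathcomp Require Import all_classical all_reals all_analysis.
From mathcomp Require Import lra zify.

(** In a bipartite graph an Eulerian arc set has as many arcs leaving one colour
    class as entering it, hence an even number of arcs, so every orientation is
    an AT-orientation and only the outdegree bounds matter.

    An outerplanar drawing contains no subdivision of K_{2,3}: the branch
    vertices, together with a point of the outer face joined to one inner vertex
    of each of the three paths, would give nine compact connected sets realising
    K_{3,3} in the plane, with disjoint sets for disjoint edges.  Sampling these
    sets by fine chains of points, the number of crossings of two chains is even
    when they are far apart, but it can also be expressed, modulo 2, through the
    positions of the end points and through vertical rays from them; summing
    over all pairs of disjoint edges of K_{3,3}, the ray contributions cancel
    and the total is odd.

    In a 2-connected graph without such a subdivision, an ear attached to a
    cycle has its ends adjacent on the cycle and lengthens it, so there is a
    Hamilton cycle; by bipartiteness its chords do not cross.  Orient the cycle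
    cyclically, and number the vertices along it.  A chord is the longest
    rightward chord at its left end or the longest leftward chord at its right
    end; orient it away from such an end.  Then every vertex has an in-neighbour
    and at most 1 + 2 out-neighbours. *)

Set Implicit Arguments.
Unset Strict Implicit.
Unset Printing Implicit Defensive.

Import Order.TTheory GRing.Theory Num.Theory.
Import numFieldNormedType.Exports.

(** * Parity of crossings of polygonal chains *)

Lemma addb_xorb a b : a (+) b = xorb a b.
Proof. by case: a; case: b. Qed.

(** A linear combination over the field with two elements: what is left of a parity identity is a
    tautology for [btauto]. *)
Lemma addb_eq2 (a1 b1 a2 b2 a b : bool) : a1 = b1 -> a2 = b2 ->
  a (+) b = (a1 (+) b1) (+) (a2 (+) b2) -> a = b.
Proof. by move=> -> ->; case: a; case: b; case: b1; case: b2. Qed.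

Section CrossingParity.
Local Open Scope ring_scope.
Variable R : realType.
Implicit Types (a b c d : R * R) (s t : seq (R * R)) (e : R).

(** Ties are broken by the other coordinate, so that distinct points are always comparable and need
    not be in general position. *)
Definition ltx a b := (a.1 < b.1) || ((a.1 == b.1) && (a.2 < b.2)).
Definition lty a b := (a.2 < b.2) || ((a.2 == b.2) && (a.1 < b.1)).

Lemma ltxC a b : a != b -> ltx b a = ~~ ltx a b.
Proof.
case: a b => [x y] [z w]; rewrite /ltx /= xpair_eqE.
by case: ltgtP => //= _; case: ltgtP.
Qed.

Lemma ltyC a b : a != b -> lty b a = ~~ lty a b.
Proof.
case: a b => [x y] [z w]; rewrite /lty /= xpair_eqE.
by case: (ltgtP y w) => //= _; case: (ltgtP x z).
Qed.

Lemma ltx_between a b c :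
  ltx a b (+) ltx a c -> b.1 <= a.1 <= c.1 \/ c.1 <= a.1 <= b.1.
Proof.
rewrite /ltx; case: (ltgtP a.1 b.1); case: (ltgtP a.1 c.1) => //= *;
  by [left; lra | right; lra].
Qed.

Lemma lty_between a b c :
  lty a b (+) lty a c -> b.2 <= a.2 <= c.2 \/ c.2 <= a.2 <= b.2.
Proof.
rewrite /lty; case: (ltgtP a.2 b.2); case: (ltgtP a.2 c.2) => //= *;
  by [left; lra | right; lra].
Qed.

Definition close e a b := (`|a.1 - b.1| < e) && (`|a.2 - b.2| < e).

Lemma closexx e a : 0 < e -> close e a a.
Proof. by move=> e0; rewrite /close !subrr normr0 e0. Qed.

(* The edge [c d] is replaced by the horizontal segment from c to (d.1, c.2)
   followed by a vertical one; this tells whether the upward ray from a meets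
   the former. *)
Definition ray a c d := lty a c && (ltx c a (+) ltx d a).

Fixpoint rays a c s :=
  if s is d :: s' then ray a c d (+) rays a d s' else false.

(* The two sides differ by the parity of the number of crossings of the
   L-shaped edges [a b] and [c d]. *)
Lemma step_parity e a b c d : 0 < e -> close e a b -> close e c d ->
  ~~ close e a c -> ~~ close e a d -> ~~ close e b c -> ~~ close e b d ->
  ray a c d (+) ray b c d (+) ray c a b (+) ray d a b
  = ltx c a (+) ltx c b (+) ltx d a (+) ltx d b.
Proof.
move=> e0 /andP[ab1 ab2] /andP[cd1 cd2] nac nad nbc nbd.
have neq x y : ~~ close e x y -> x != y.
  by apply: contraNneq => ->; exact: closexx.
(* The vertical leg of [c d] does not cross the horizontal leg of [a b]: otherwise d.1 lies between
   a.1 and b.1, and a.2 between c.2 and d.2, so a is close to d. Likewise [H2] treats the other two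
   legs, whose crossing would make b close to c. *)
have H1 : (ltx d a (+) ltx d b) && (lty a c (+) lty a d) = false.
  apply/negbTE; apply: contra nad => /andP[/ltx_between h1 /lty_between h2].
  rewrite /close; move: ab1 cd2; rewrite !ltr_norml.
  by case: h1 => /andP[??]; case: h2 => /andP[??] /andP[??] /andP[??]; lra.
have H2 : (ltx b c (+) ltx b d) && (lty c a (+) lty c b) = false.
  apply/negbTE; apply: contra nbc => /andP[/ltx_between h1 /lty_between h2].
  rewrite /close; move: ab2 cd1; rewrite !ltr_norml.
  by case: h1 => /andP[??]; case: h2 => /andP[??] /andP[??] /andP[??]; lra.
move: H1 H2; rewrite /ray.
rewrite (ltxC (neq _ _ nac)) (ltxC (neq _ _ nad)).
rewrite (ltxC (neq _ _ nbc)) (ltxC (neq _ _ nbd)).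
rewrite (ltyC (neq _ _ nac)) ?(ltyC (neq _ _ nad)).
rewrite (ltyC (neq _ _ nbc)) ?(ltyC (neq _ _ nbd)).
move=> h1 h2; apply: addb_eq2 h1 h2 _.
by rewrite !addb_xorb; btauto.
Qed.

Lemma step_chain_parity e a b c t : 0 < e -> close e a b ->
  path (close e) c t ->
  (forall y, y \in c :: t -> ~~ close e a y /\ ~~ close e b y) ->
  rays a c t (+) rays b c t (+) ray c a b (+) ray (last c t) a b
  = ltx c a (+) ltx c b (+) ltx (last c t) a (+) ltx (last c t) b.
Proof.
move=> e0 ab; elim: t c => [|d t IH] c /=.
  by move=> _ _; case: (ray c a b) (ltx c a) (ltx c b) => [] [] [].
case/andP=> cd pt far.
have [ac bc] := far c (mem_head _ _).
have [ad bd] := far d (@mem_behead _ (c :: d :: t) d (mem_head _ _)).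
have := step_parity e0 ab cd ac ad bc bd.
have /IH : path (close e) d t by [].
have far' y : y \in d :: t -> ~~ close e a y /\ ~~ close e b y.
  by move=> yt; apply: far; rewrite inE yt orbT.
move=> /(_ far').
set l := last d t.
move=> h1 h2; apply: addb_eq2 h1 h2 _.
by rewrite /= !addb_xorb; btauto.
Qed.

(** The same summation along the chain from a, so that only the four end points of the two chains
    remain. *)
Lemma chain_parity e a s c t : 0 < e -> path (close e) a s ->
  path (close e) c t ->
  (forall x y, x \in a :: s -> y \in c :: t -> ~~ close e x y) ->
  rays a c t (+) rays (last a s) c t (+) rays c a s (+) rays (last c t) a s
  = ltx c a (+) ltx c (last a s) (+) ltx (last c t) a
    (+) ltx (last c t) (last a s).
Proof.
move=> e0 + pt; elim: s a => [|b s IH] a /=.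
  move=> _ _; move: (rays a c t) (ltx c a) (ltx (last c t) a).
  by do 3 case.
case/andP=> ab ps far.
have far1 y : y \in c :: t -> ~~ close e a y /\ ~~ close e b y.
  by move=> yt; split; apply: far => //; rewrite !inE eqxx ?orbT.
have := step_chain_parity e0 ab pt far1.
have far2 x y : x \in b :: s -> y \in c :: t -> ~~ close e x y.
  by move=> xs; apply: far; rewrite inE xs orbT.
have := IH _ ps far2.
set l := last b s; set m := last c t.
move=> h1 h2; apply: addb_eq2 h1 h2 _.
by rewrite /= !addb_xorb; btauto.
Qed.

End CrossingParity.

(** * Compact connected sets in the plane *)

Section PlaneTopology.
Local Open Scope ring_scope.
Local Open Scope classical_set_scope.

(** The trace of S on C is nonempty, relatively open and relatively closed. *)
Lemma connected_locally_constant (T : topologicalType) (C : set T)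
    (S : T -> Prop) (p q : T) : connected C ->
  (forall x, C x -> \forall y \near x, C y -> (S x <-> S y)) ->
  C p -> C q -> S p -> S q.
Proof.
move=> cC loc Cp Cq Sp.
suff E : C `&` S = C by move: Cq; rewrite -{1}E => -[].
apply: cC; first by exists p.
- exists (interior [set y | C y -> S y]); first exact: open_interior.
  rewrite eqEsubset; split=> x [Cx].
    move=> Sx; split=> //; apply: filterS (loc x Cx) => y h Cy.
    by apply/h.
  by move=> /nbhs_singleton /= h; split=> //; exact: h.
- exists (~` interior [set y | C y -> ~ S y]).
    by apply: open_closedC; exact: open_interior.
  rewrite eqEsubset; split=> x [Cx].
    by move=> Sx; split=> // /nbhs_singleton /= h; exact: (h Cx).
  move=> nS; split=> //; apply: contrapT => nSx; apply: nS.
  by apply: filterS (loc x Cx) => y h Cy Sy; apply: nSx; apply/(h Cy).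
Qed.

Variable R : realType.
Implicit Types (p q x y z : R * R) (A B C W : set (R * R)) (e : R).

Lemma closeE e x y : ball x e y = close e x y.
Proof.
rewrite /close propeqE; split.
  by move=> [/= h1 h2]; apply/andP; split.
by move=> /andP[h1 h2]; split.
Qed.

Lemma near_close e x : 0 < e -> \forall y \near x, close e x y.
Proof.
move=> e0; have := nbhsx_ballx x e e0.
by apply: filterS => y; rewrite closeE.
Qed.

Lemma closeC e x y : close e x y = close e y x.
Proof. by rewrite /close distrC [X in _ && (X < _)]distrC. Qed.

(** Being reachable from p by an e-chain inside C is a locally constant property on C. *)
Lemma connected_chain C p q e : 0 < e -> connected C -> C p -> C q ->
  exists s, [/\ path (close e) p s, last p s = q &
                forall y, y \in p :: s -> C y].
Proof.
move=> e0 cC Cp Cq.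
pose S z := exists s, [/\ path (close e) p s, last p s = z &
                forall y, y \in p :: s -> C y].
have step x y : C y -> close e x y -> S x -> S y.
  move=> Cy xy [s [ps ls sC]]; exists (rcons s y); split.
  - by rewrite rcons_path ps ls.
  - by rewrite last_rcons.
  - by move=> z; rewrite -rcons_cons mem_rcons inE => /predU1P[->//|/sC].
suff : S q by [].
apply: (connected_locally_constant cC _ Cp Cq).
  move=> x Cx; apply: filterS (near_close x e0) => y xy Cy.
  by split; apply: step => //; rewrite closeC.
by exists [::]; split=> // y; rewrite inE => /eqP->.
Qed.

(** Each x in A has a ball of radius r that avoids B; no point within r/2 of x is then e-close to B
    for e < r/2. Compactness makes the bound on e uniform. *)
Lemma compact_far A B : compact A -> closed B -> (forall x, A x -> ~ B x) ->
  \forall e \near 0^'+, forall a b, A a -> B b -> ~~ close e a b.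
Proof.
move=> /compact_near_coveringP cA cB AB.
suff : \forall e \near 0^'+,
    A `<=` [set a | forall b, B b -> ~~ close (e : R) a b].
  by apply: filterS => e h a b Aa Bb; exact: h.
apply: cA => x Ax.
have : nbhs x (~` B).
  by apply: open_nbhs_nbhs; split; [exact: closed_openC | exact: AB].
rewrite -nbhs_ballE => -[r /= r0 rB].
have r20 : 0 < r / 2 by rewrite divr_gt0.
near=> a e => b Bb; apply/negP => ab; apply: (rB b) => //=.
rewrite closeE; move: ab => /=.
have /andP[] : close (r / 2) x a by near: a; exact: near_close.
have : e < r / 2 by near: e; exact: nbhs_right_lt.
rewrite /close !ltr_norml => ? /andP[??] /andP[??] /andP[/andP[??] /andP[??]].
by apply/andP; split; apply/andP; split; lra.
Unshelve. all: by end_near. Qed.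

(** Compact connected sets replace paths: they are glued by mere union, and the argument on K_{3,3}
    asks for nothing more. *)
Definition linked W p q :=
  exists K : set (R * R), [/\ compact K, connected K, K p, K q & K `<=` W].

Lemma linked_refl W p : W p -> linked W p p.
Proof.
move=> Wp; exists [set p]; split=> //; first exact: compact_set1.
- exact: connected1.
- by move=> _ ->.
Qed.

Lemma linked_sym W p q : linked W p q -> linked W q p.
Proof. by move=> [K [? ? ? ? ?]]; exists K. Qed.

Lemma linked_trans W p q r : linked W p q -> linked W q r -> linked W p r.
Proof.
move=> [K [K1 K2 K3 K4 K5]] [L [L1 L2 L3 L4 L5]].
exists (K `|` L); split.
- exact: compactU.
- by apply: connectedU => //; exists q.
- by left.
- by right.
- by move=> z [/K5|/L5].
Qed.

Lemma linked_sub W W' p q : W `<=` W' -> linked W p q -> linked W' p q.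
Proof.
by move=> WW' [K [? ? ? ? KW]]; exists K; split=> //; exact: subset_trans WW'.
Qed.

Lemma linked_segment e W x y : (forall z, close e x z -> W z) ->
  close e x y -> linked W x y.
Proof.
move=> xW xy.
pose g (t : R) : R * R := (x.1 + t * (y.1 - x.1), x.2 + t * (y.2 - x.2)).
have cg : continuous g.
  have aff (u v : R) : continuous (fun t : R => u + t * v).
    move=> t; apply: cvgD; first exact: cvg_cst.
    by apply: cvgM; [exact: cvg_id | exact: cvg_cst].
  by move=> t; exact: cvg_pair (aff _ _ t) (aff _ _ t).
exists (g @` `[0, 1]); split.
- apply: continuous_compact; last exact: segment_compact.
  exact: continuous_subspaceT.
- apply: connected_continuous_connected; first exact: segment_connected.
  exact: continuous_subspaceT.
- exists 0; first by rewrite /= in_itv /= lexx ler01.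
  by rewrite /g !mul0r !addr0 -surjective_pairing.
- exists 1; first by rewrite /= in_itv /= lexx ler01.
  by rewrite /g !mul1r !subrKC -surjective_pairing.
move=> _ [t /= t01 <-]; apply: xW.
move: t01; rewrite in_itv /= => /andP[t0 t1].
move: xy; rewrite /close /= => /andP[h1 h2].
by apply/andP; split; [move: h1 | move: h2]; apply: le_lt_trans;
  rewrite opprD addNKr normrN normrM distrC ger0_norm // ler_piMl.
Qed.

(** Being linked to p inside W is locally constant on C, since segments join a point of C to all
    points of a small ball around it. *)
Lemma linked_open W C p q : open W -> connected C -> C `<=` W ->
  C p -> C q -> linked W p q.
Proof.
move=> oW cC CW Cp Cq.
apply: (connected_locally_constant (S := linked W p) cC _ Cp Cq).
  move=> x Cx.
  have : nbhs x W by apply: open_nbhs_nbhs; split=> //; exact: CW.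
  rewrite -nbhs_ballE => -[r /= r0 rW].
  apply: filterS (near_close x r0) => y xy Cy.
  have xyW : linked W x y.
    by apply: (@linked_segment r) => // z xz; apply: rW; rewrite closeE.
  by split=> h; apply: linked_trans h _ => //; exact: linked_sym.
by apply: linked_refl; exact: CW.
Qed.

Lemma K33_not_planar (V U : 'I_3 -> R * R) (K : 'I_3 -> 'I_3 -> set (R * R)) :
  (forall i j, [/\ compact (K i j), connected (K i j),
                   K i j (V i) & K i j (U j)]) ->
  (forall i i' j j', i != i' -> j != j' -> forall z, K i j z -> ~ K i' j' z) ->
  False.
Proof.
move=> hK disj.
(* A single e serves for all pairs of disjoint edges, because there are finitely many. *)
have : \forall e \near (0 : R)^'+, forall h : 'I_3 * 'I_3 * 'I_3 * 'I_3,
    h.1.1.1 != h.1.1.2 -> h.1.2 != h.2 -> forall a b,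
    K h.1.1.1 h.1.2 a -> K h.1.1.2 h.2 b -> ~~ close e a b.
  apply: filter_forall => -[[[i i'] j] j'] /=.
  case: (eqVneq i i') => ii'; first by apply: nearW.
  case: (eqVneq j j') => jj'; first by apply: nearW.
  have [cK _ _ _] := hK i j; have [cK' _ _ _] := hK i' j'.
  have cl := compact_closed (@norm_hausdorff _ _) cK'.
  have := compact_far cK cl (disj _ _ _ _ ii' jj').
  by apply: filterS => e h _ _.
move=> /(filterI (nbhs_right_gt (0 : R))) /filter_ex[e [/= e0 far]].
have /choice[s sP] : forall h : 'I_3 * 'I_3, exists s,
    [/\ path (close e) (V h.1) s, last (V h.1) s = U h.2 &
        forall y, y \in V h.1 :: s -> K h.1 h.2 y].
  by move=> [i j]; have [_ cK Ki Kj] := hK i j; exact: connected_chain.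
(* The sum of the two sides of [chain_parity] for the edges (i, j) and (i', j'). *)
pose F i j i' j' := rays (V i) (V i') (s (i', j')) (+)
  rays (U j) (V i') (s (i', j')) (+) rays (V i') (V i) (s (i, j)) (+)
  rays (U j') (V i) (s (i, j)) (+) (ltx (V i') (V i) (+) ltx (V i') (U j) (+)
  ltx (U j') (V i) (+) ltx (U j') (U j)).
have F0 i j i' j' : i != i' -> j != j' -> F i j i' j' = false.
  move=> ii' jj'; rewrite /F.
  have [p1 l1 k1] := sP (i, j); have [p2 l2 k2] := sP (i', j').
  have fr x y : x \in V i :: s (i, j) -> y \in V i' :: s (i', j') ->
      ~~ close e x y.
    by move=> /k1 xs /k2 ys; exact: (far (i, i', j, j') ii' jj').
  have := chain_parity e0 p1 p2 fr; rewrite l1 l2 /= => ->.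
  by rewrite addbb.
pose o0 : 'I_3 := Ordinal (isT : (0 < 3)%N).
pose o1 : 'I_3 := Ordinal (isT : (1 < 3)%N).
pose o2 : 'I_3 := Ordinal (isT : (2 < 3)%N).
(* V i and U j are distinct because they lie on the disjoint edges (i, j') and (i', j). *)
have VU i j : ltx (U j) (V i) = ~~ ltx (V i) (U j).
  apply: ltxC.
  have [i' ii'] : exists i', i != i'.
    by case: (eqVneq i o0) => [->|?]; [exists o1 | exists o0].
  have [j' jj'] : exists j', j' != j.
    by case: (eqVneq j o0) => [->|?]; [exists o1 | exists o0; rewrite eq_sym].
  apply/eqP => E; have [_ _ h1 _] := hK i j'; have [_ _ _ h2] := hK i' j.
  by apply: (disj _ _ _ _ ii' jj' _ h1); rewrite E.
have UU j j' : j != j' -> ltx (U j') (U j) = ~~ ltx (U j) (U j').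
  move=> jj'; apply: ltxC; apply/eqP => E.
  have [_ _ _ h1] := hK o0 j; have [_ _ _ h2] := hK o1 j'.
  by apply: (disj o0 o1 _ _ isT jj' _ h1); rewrite E.
(* The 18 unordered pairs of disjoint edges. A ray term of a vertex and an edge occurs twice, since
   two of the edges at the vertex are disjoint from the given edge. For each pair i < i', every two
   distinct U j, U j' are compared in both directions, contributing 1, nine times in all; the other
   comparisons occur an even number of times. *)
have : F o0 o0 o1 o1 (+) F o0 o0 o1 o2 (+) F o0 o1 o1 o2 (+)
  F o0 o1 o1 o0 (+) F o0 o2 o1 o0 (+) F o0 o2 o1 o1 (+)
  F o0 o0 o2 o1 (+) F o0 o0 o2 o2 (+) F o0 o1 o2 o2 (+)
  F o0 o1 o2 o0 (+) F o0 o2 o2 o0 (+) F o0 o2 o2 o1 (+)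
  F o1 o0 o2 o1 (+) F o1 o0 o2 o2 (+) F o1 o1 o2 o2 (+)
  F o1 o1 o2 o0 (+) F o1 o2 o2 o0 (+) F o1 o2 o2 o1 = false.
  by rewrite !F0.
rewrite /F !VU (UU o0 o1) // (UU o0 o2) // (UU o1 o2) // !addb_xorb.
set T := (X in X = false); have -> // : T = true.
by rewrite /T; btauto.
Qed.

End PlaneTopology.

(** * Bipartite graphs, ears and Hamilton cycles *)

Section Combinatorics.
Variable G : sgraph.
Implicit Types (x y z u v w : G) (s t c : seq G).

(** * Eulerian arc sets in bipartite graphs *)

Lemma sum_outdegree (H : {set G * G}) (A : {set G}) :
  \sum_(v in A) outdegree H v = #|[set a in H | a.1 \in A]|.
Proof.
rewrite -sum1_card.
rewrite (partition_big (fun a : G * G => a.1) (mem A)) /=; last first.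
  by move=> [x y]; rewrite inE => /andP[].
apply: eq_bigr => v vA; rewrite /outdegree -sum1_card.
rewrite (reindex_onto (fun u => (v, u)) snd) /=; last first.
  by move=> [x y] /andP[_ /eqP /= ->].
by apply: eq_bigl => u; rewrite !inE /= vA !eqxx !andbT.
Qed.

Lemma sum_indegree (H : {set G * G}) (A : {set G}) :
  \sum_(v in A) indegree H v = #|[set a in H | a.2 \in A]|.
Proof.
rewrite -sum1_card.
rewrite (partition_big (fun a : G * G => a.2) (mem A)) /=; last first.
  by move=> [x y]; rewrite inE => /andP[].
apply: eq_bigr => v vA; rewrite /indegree -sum1_card.
rewrite (reindex_onto (fun u => (u, v)) fst) /=; last first.
  by move=> [x y] /andP[_ /eqP /= ->].
by apply: eq_bigl => u; rewrite !inE /= vA !eqxx !andbT.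
Qed.

Lemma bipartite_eulerian_even (D H : {set G * G}) :
  bipartite G -> orientation D -> H \subset D -> eulerian H -> ~~ odd #|H|.
Proof.
move=> [c cP] [oD _] HD /forallP eH.
pose A := [set v | c v].
have key : #|[set a in H | a.1 \in A]| = #|[set a in H | a.2 \in A]|.
  by rewrite -sum_outdegree -sum_indegree; apply: eq_bigr => v _; apply/eqP.
(* Every arc of H has exactly one end in the colour class A. *)
have -> : #|H| = #|[set a in H | a.1 \in A]| + #|[set a in H | a.2 \in A]|.
  rewrite -cardsUI [X in _ + X](_ : _ = 0) ?addn0.
    apply: eq_card => -[x y]; rewrite !inE /= -andb_orr.
    case: (boolP ((x, y) \in H)) => //= xyH.
    have /cP : adj x y by rewrite oD (fintype.subsetP HD).
    by case: (c x) (c y) => [] [].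
  apply/eqP; rewrite cards_eq0; apply/eqP/setP => -[x y]; rewrite !inE /=.
  case: (boolP ((x, y) \in H)) => //= xyH.
  have /cP : adj x y by rewrite oD (fintype.subsetP HD).
  by case: (c x) (c y) => [] [].
by rewrite key addnn odd_double.
Qed.

Lemma bipartite_AT_orientation (D : {set G * G}) :
  bipartite G -> orientation D -> AT_orientation D.
Proof.
move=> bG oD; split=> //; apply/eqP; rewrite eq_sym.
have -> : odd_eulerian D = finset.set0.
  apply/setP => H; rewrite !inE; apply/negbTE/negP => /and3P[HD eH].
  by apply/negP; exact: (bipartite_eulerian_even bG oD HD eH).
rewrite cards0 eq_sym -lt0n; apply/card_gt0P; exists finset.set0.
rewrite inE finset.sub0set cards0 andbT; apply/forallP => v.
rewrite /outdegree /indegree; apply/eqP/eq_card => u.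
by rewrite !inE.
Qed.

(* A subdivision of K_{2,3} with branch vertices x and y. *)
Definition theta x y s1 s2 s3 : Prop :=
  [/\ uniq (x :: y :: s1 ++ s2 ++ s3),
      [/\ s1 != [::], s2 != [::] & s3 != [::]] &
      [/\ path (@adj G) x (rcons s1 y), path (@adj G) x (rcons s2 y)
        & path (@adj G) x (rcons s3 y)]].

Definition theta_free : Prop := forall x y s1 s2 s3, ~ theta x y s1 s2 s3.

(** * Ears and a Hamilton cycle *)

Lemma path_adj_rev x s y :
  path (@adj G) x (rcons s y) = path (@adj G) y (rcons (rev s) x).
Proof.
have := rev_path (@adj G) x (rcons s y).
rewrite last_rcons belast_rcons rev_cons => ->.
by apply: eq_path => u v; rewrite adj_sym.
Qed.

(** Connectedness gives an edge from some x on c to some v off c. With x deleted, v is still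
    connected to another vertex of c, and the first return to c gives y. *)
Lemma ear_exists (c : seq G) (w : G) : k_connected G 2 -> uniq c ->
  1 < size c -> w \notin c ->
  exists x y s, [/\ x \in c, y \in c, x != y, s != [::] &
   [/\ uniq s, {in s, forall v, v \notin c} & path (@adj G) x (rcons s y)]].
Proof.
move=> [_ kG] uc sc wc.
pose C := [set v in c].
have [x [v [xc vc xv]]] : exists x v, [/\ x \in c, v \notin c & adj x v].
  have [z zc] : exists z, z \in c.
    by case: (c) sc => // z ? _; exists z; rewrite mem_head.
  have /connectP[p] : connect (adj_off finset.set0) z w.
    by apply: kG; rewrite ?cards0 ?inE.
  elim: p z zc => [|u p IH] z zc /=.
    by move=> _ wz; rewrite wz zc in wc.
  case/andP=> /and3P[_ _ zu] pu lw.
  by case: (boolP (u \in c)) => [/IH|uc']; [exact | exists z, u].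
have [z zc xz] : exists2 z, z \in c & z != x.
  case: (c) uc sc => [|a [|b r]] // /andP[ab _] _.
  case: (eqVneq a x) => [ax|ax]; last by exists a; rewrite ?mem_head.
  exists b; first by rewrite !inE eqxx orbT.
  by apply: contraNneq ab; rewrite -ax => ->; rewrite mem_head.
have vx : v != x by apply: contraNneq vc => ->.
have [v' [y [vv' yc yx v'y]]] : exists v' y,
    [/\ connect (adj_off C) v v', y \in c, y != x & adj v' y].
  have /connectP[p] : connect (adj_off [set x]%SET) v z.
    by apply: kG; rewrite ?cards1 ?inE.
  have walk a : a \notin c -> connect (adj_off C) v a ->
      path (adj_off [set x]%SET) a p -> z = last a p ->
      exists v' y, [/\ connect (adj_off C) v v', y \in c, y != x & adj v' y].
    elim: p a => [|b p IH] a ac va /=.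
      by move=> _ za; rewrite -za zc in ac.
    case/andP=> /and3P[_]; rewrite inE => bx ab pb lb.
    case: (boolP (b \in c)) => bc; first by exists a, b.
    apply: (IH b) => //; apply: (connect_trans va); apply: connect1.
    by rewrite /adj_off /= !inE ac bc ab.
  exact: walk vc (connect0 _ _).
have [p pp lp] := connectP vv'.
case/shortenP: pp lp => q pq uq _ lq.
have qc : {in v :: q, forall a, a \notin c}.
  move=> a; rewrite inE => /predU1P[-> //|].
  move: pq; elim: (q) v {vc xv vx vv' p uq lq} => // b r IH a'.
  case/andP=> /and3P[_ bc _] pr.
  by rewrite inE => /predU1P[->|/(IH _ pr) //]; rewrite inE in bc.
exists x, y, (v :: q); split=> //; first by rewrite eq_sym.
split=> //=; rewrite xv rcons_path -lq v'y andbT.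
by apply: sub_path pq => a b /and3P[].
Qed.

(** x and y cut the cycle into two paths with interiors s1 and s2. If one interior is empty, the ear
    replaces that edge; otherwise s1, s2 and the ear form a [theta]. *)
Lemma ear_extend x y s c : theta_free -> x \in c -> y \in c -> x != y ->
  s != [::] -> uniq s -> {in s, forall v, v \notin c} ->
  path (@adj G) x (rcons s y) -> ucycle (@adj G) c ->
  exists2 c', ucycle (@adj G) c' & size c < size c'.
Proof.
move=> tG xc yc xy s0 us sc ps /andP[cc uc].
have [i r Er] := rot_to xc.
have sr : {in s, forall v, v \notin x :: r}.
  by move=> v /sc; rewrite -Er mem_rot.
have : y \in x :: r by rewrite -Er mem_rot.
rewrite inE eq_sym (negbTE xy) => /= /splitPr yr.
have szc : size c = size (x :: r) by rewrite -Er size_rot.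
move: cc uc; rewrite -(rot_cycle i) -(rot_uniq i) Er.
case: r / yr szc sr {Er} => [s1 s2] szc sr cr ur.
move: (cr); rewrite /= rcons_cat /= -cat_rcons cat_path last_rcons.
case/andP=> p1 p2.
have szs : 0 < size s by rewrite lt0n size_eq0.
have snx : x \notin s by apply/negP => /sr; rewrite mem_head.
have sny : y \notin s by apply/negP => /sr; rewrite !inE mem_cat mem_head !orbT.
have ds1 : ~~ has (mem s) s1.
  by apply/hasPn => v vs1; apply/negP => /sr; rewrite inE mem_cat vs1 orbT.
have ds2 : ~~ has (mem s) s2.
  by apply/hasPn => v vs1; apply/negP => /sr; rewrite !(inE, mem_cat) vs1 !orbT.
move: (ur); rewrite /= mem_cat inE cat_uniq /= !negb_or.
case/and3P=> /and3P[xs1 _ xs2] us1 /andP[/andP[ys1 d12] /andP[ys2 us2]].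
case: (eqVneq s1 [::]) => [s10|s1n].
  exists (x :: rcons s y ++ s2); last first.
    rewrite szc s10 /= size_cat size_rcons addSn !ltnS.
    by rewrite -[X in X < _]add0n ltn_add2r.
  apply/andP; split; first by rewrite /= rcons_cat cat_path ps last_rcons.
  rewrite /= mem_cat mem_rcons inE (negbTE xy) (negbTE xs2) (negbTE snx) /=.
  rewrite cat_uniq rcons_uniq sny us us2 /= andbT.
  apply/hasPn => v v2; rewrite /= mem_rcons inE negb_or (hasPn ds2) // andbT.
  by apply: contraNneq ys2 => <-.
case: (eqVneq s2 [::]) => [s20|s2n].
  exists (x :: rcons s1 y ++ rev s).
    apply/andP; split.
      by rewrite /= rcons_cat cat_path p1 last_rcons -path_adj_rev.
    rewrite /= mem_cat mem_rcons mem_rev in_cons (negbTE xy) (negbTE xs1).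
    rewrite (negbTE snx) /= cat_uniq rcons_uniq ys1 us1 rev_uniq us andbT /=.
    rewrite andbT; apply/hasPn => v; rewrite mem_rev => vs.
    apply: contraL vs => /=.
    by rewrite mem_rcons inE => /predU1P[->//|]; move/(hasPn ds1).
  rewrite szc s20 /= !size_cat size_rcons size_rev /= addn1 !ltnS.
  by rewrite -[X in X < _]addn0 ltn_add2l.
case: (tG x y s1 (rev s2) s); split; last first.
- by split=> //; rewrite path_adj_rev revK.
- by split=> //; rewrite -size_eq0 size_rev size_eq0.
rewrite /= !inE !(mem_cat, mem_rev, negb_or) xy xs1 xs2 snx ys1 ys2 sny /=.
rewrite !cat_uniq us1 rev_uniq us2 us has_cat has_rev !negb_or d12 /= andbT.
by rewrite has_sym ds1 has_sym has_rev ds2.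
Qed.

Lemma hamiltonian : k_connected G 2 -> theta_free ->
  exists2 c, ucycle (@adj G) c & forall v, v \in c.
Proof.
move=> kG tG.
(* Induction on a bound n for the number of vertices that c misses. *)
have ext n c : #|G| - size c <= n -> 1 < size c -> ucycle (@adj G) c ->
    exists2 c, ucycle (@adj G) c & forall v, v \in c.
  elim: n c => [|n IH] c szc c1 cc.
    exists c => // v; move: szc; rewrite leqn0 subn_eq0 => szc.
    have /andP[_ uc] := cc.
    have sub : {subset c <= enum G} by move=> x _; rewrite mem_enum.
    by rewrite (uniq_min_size uc sub) ?mem_enum // -cardE.
  case: (boolP [forall v, v \in c]) => [/forallP|]; first by exists c.
  move=> /forallPn[w wc]; have /andP[_ uc] := cc.
  have [x [y [s [xc yc xy s0 [us sc ps]]]]] := ear_exists kG uc c1 wc.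
  have [c' cc' lt_c] := ear_extend tG xc yc xy s0 us sc ps cc.
  apply: (IH c') => //; last exact: ltn_trans lt_c.
  rewrite -ltnS; apply: leq_trans szc; apply: ltn_sub2l => //.
  have -> : size c = #|[set x in c]| by rewrite cardsE (card_uniqP uc).
  rewrite -cardsT; apply: proper_card; apply/properP; split.
    exact: finset.subsetT.
  by exists w; rewrite !inE.
have [G2 conn] := kG.
have /card_gt0P[x _] : 0 < #|G| by exact: ltn_trans G2.
have : 0 < #|[set~ x]%SET| by rewrite cardsC1; case: #|G| G2 => // -[].
move=> /card_gt0P[y]; rewrite !inE => yx.
have /connectP[[|z p] /=] : connect (adj_off finset.set0) x y.
    by apply: conn; rewrite ?cards0 ?inE.
  by move=> _ E; rewrite E eqxx in yx.
case/andP=> /and3P[_ _ xz] _ _.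
(* An edge run back and forth is a [ucycle] of length 2, from which the extension by ears starts. *)
apply: (ext #|G| [:: x; z]) => //; first exact: leq_subr.
rewrite /ucycle /= xz adj_sym xz inE /=.
by rewrite andbT; apply: contraTneq xz => ->; rewrite adj_irrefl.
Qed.

(** * Crossing chords of a cycle *)

Lemma long_crossing x y z w s1 s2 s3 s4 : theta_free -> s1 != [::] ->
  ucycle (@adj G) (x :: s1 ++ y :: s2 ++ z :: s3 ++ w :: s4) ->
  adj x z -> adj y w -> False.
Proof.
move=> tG s1n /andP[cc uc] xz yw.
(* The three paths from x to y are: along s1; the chord to z, then s2 backwards; s4 backwards to w,
   then the chord to y. Only s3 is left out. *)
apply: (tG x y s1 (z :: rev s2) (rcons (rev s4) w)).
move: cc; rewrite /= !(rcons_cat, rcons_cons) -!cat_rcons.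
rewrite !cat_path !last_rcons => /and4P[p1 p2 p3 p4].
split.
- suff : uniq ((x :: y :: s1 ++ (z :: rev s2) ++ rcons (rev s4) w) ++ s3).
    by rewrite cat_uniq => /andP[].
  rewrite -(perm_uniq (s1 := x :: s1 ++ y :: s2 ++ z :: s3 ++ w :: s4)) //.
  apply/permP => p; rewrite -cats1 /= !(count_cat, count_rev) /=.
  do 2! rewrite !(count_cat, count_rev) /=; lia.
- by split=> //; case: (rev s4).
- split=> //=; first by rewrite xz -path_adj_rev.
  by rewrite rcons_path last_rcons adj_sym yw andbT -path_adj_rev.
Qed.

(** If s1 or s2 is nonempty, [long_crossing] applies, in the second case after a rotation. If both
    are empty, x, y, z form a triangle, which has no 2-colouring. *)
Lemma no_crossing x y z w s1 s2 s3 s4 : theta_free -> bipartite G ->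
  ucycle (@adj G) (x :: s1 ++ y :: s2 ++ z :: s3 ++ w :: s4) ->
  adj x z -> adj y w -> False.
Proof.
move=> tG [f fP] cc xz yw.
case: (eqVneq s1 [::]) => [E1|n1]; last exact: (long_crossing tG n1 cc).
case: (eqVneq s2 [::]) => [E2|n2]; last first.
  have zx : adj z x by rewrite adj_sym.
  apply: (@long_crossing y z w x s2 s3 s4 s1 tG n2 _ yw zx).
  rewrite -(rot_ucycle (size (x :: s1))) in cc.
  have -> // : y :: s2 ++ z :: s3 ++ w :: s4 ++ x :: s1
    = rot (size (x :: s1)) (x :: s1 ++ y :: s2 ++ z :: s3 ++ w :: s4).
  by rewrite (rot_size_cat (x :: s1)) /= -catA /= -catA.
move: cc xz => /andP[cc _] /fP; rewrite E1 E2 in cc.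
case/and3P: cc => /fP xy /fP yz _.
by case: (f x) (f y) (f z) xy yz => [] [] [].
Qed.

End Combinatorics.

(** * Orienting a Hamilton cycle and its chords *)

Section CyclicOrientation.
Variables (G : sgraph) (c : seq G).
Hypotheses (cc : ucycle (@adj G) c) (c_all : forall v : G, v \in c).
Hypotheses (c3 : 2 < size c).
Implicit Types u v w x y z : G.

Let uc : uniq c. Proof. by case/andP: cc. Qed.
Local Notation pos v := (index v c).

(** Later elements keep their order in the tail s2, so that the splitting can be repeated there. *)
Lemma split_index (s : seq G) u : uniq s -> u \in s -> exists s1 s2,
  s = s1 ++ u :: s2 /\ forall w, w \in s -> index u s < index w s ->
    w \in s2 /\ index w s = index w s2 + (size s1).+1.
Proof.
move=> us /splitPr us'; case: us' us => s1 s2 us; exists s1, s2; split=> //.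
have u1 : u \notin s1.
  by move: us; rewrite cat_uniq /= => /and3P[_ /norP[]].
move=> w; rewrite !index_cat (negbTE u1) /= eqxx addn0 mem_cat inE.
case: (boolP (w \in s1)) => [|_] /=.
  by rewrite -index_mem => h _ /(ltn_trans h); rewrite ltnn.
rewrite (eq_sym u); case: (eqVneq w u) => [_|_] /=; first by rewrite addn0 ltnn.
by move=> w2 _; split=> //; lia.
Qed.

Lemma chords_noncrossing x y z w : theta_free G -> bipartite G ->
  pos x < pos y -> pos y < pos z -> pos z < pos w ->
  adj x z -> adj y w -> False.
Proof.
move=> tG bG xy yz zw axz ayw.
have [s0 [t0 [E0 h0]]] := split_index uc (c_all x).
have u0 : uniq t0 by move: uc; rewrite E0 cat_uniq /= => /and4P[].
have [y0 iy] := h0 _ (c_all y) xy.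
have [z0 iz] := h0 _ (c_all z) (ltn_trans xy yz).
have [w0 iw] := h0 _ (c_all w) (ltn_trans xy (ltn_trans yz zw)).
have yz0 : index y t0 < index z t0 by lia.
have zw0 : index z t0 < index w t0 by lia.
have [s1 [t1 [E1 h1]]] := split_index u0 y0.
have u1 : uniq t1 by move: u0; rewrite E1 cat_uniq /= => /and4P[].
have [z1 iz1] := h1 _ z0 yz0.
have [w1 iw1] := h1 _ w0 (ltn_trans yz0 zw0).
have zw1 : index z t1 < index w t1 by lia.
have [s2 [t2 [E2 h2]]] := split_index u1 z1.
have [/splitPr w2 _] := h2 _ w1 zw1.
case: w2 E2 => s3 s4 E2.
apply: (@no_crossing _ x y z w s1 s2 s3 (s4 ++ s0) tG bG _ axz ayw).
move: (cc); rewrite -(rot_ucycle (size s0)) E0 rot_size_cat E1 E2.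
by rewrite /= -catA /= -catA /= -catA.
Qed.

Definition chord u v := [&& adj u v, v != next c u & u != next c v].

Lemma chord_sym u v : chord u v = chord v u.
Proof. by rewrite /chord adj_sym [X in _ && X]andbC. Qed.

Definition rightmost u v :=
  [&& chord u v, pos u < pos v & [forall w, chord u w ==> (pos w <= pos v)]].

Definition leftmost u v :=
  [&& chord u v, pos v < pos u & [forall w, chord u w ==> (pos v <= pos w)]].

(** The right end gets a chord exactly when the left end does not, so each chord receives one
    direction without appeal to noncrossing; [arc_leftmost] then shows that such a chord is the
    longest leftward one. *)
Definition cyclic_orientation : {set G * G} :=
  [set a | [|| a.2 == next c a.1, rightmost a.1 a.2 |
    [&& chord a.1 a.2, pos a.2 < pos a.1 & ~~ rightmost a.2 a.1]]].
Local Notation D := cyclic_orientation.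

Lemma pos_inj u v : pos u = pos v -> u = v.
Proof. by move=> E; rewrite -(nth_index u (c_all u)) E nth_index. Qed.

Lemma adj_next v : adj v (next c v).
Proof. by apply: next_cycle => //; case/andP: cc. Qed.

(** On a cycle of length 2 the two cycle arcs would be opposite; [c3] excludes this. *)
Lemma next_next v : next c (next c v) != v.
Proof.
have [i r E] := rot_to (c_all v).
rewrite -!(next_rot i uc) E.
have : 2 < size (v :: r) by rewrite -E size_rot.
have : uniq (v :: r) by rewrite -E rot_uniq.
case: r {E} => [|a [|b r]] //= /and3P[]; rewrite !inE !negb_or.
move=> /and3P[va vb _] _ _ _.
by rewrite eqxx [a == v]eq_sym (negbTE va) eqxx eq_sym.
Qed.

Lemma cyclic_orientation_asym u v : (u, v) \in D -> (v, u) \notin D.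
Proof.
rewrite !inE /= => /or3P[/eqP->|h|/and3P[h1 h2 h3]].
- rewrite !negb_or eq_sym next_next /=; apply/andP; split.
    by apply/negP => /andP[/and3P[]]; rewrite eqxx.
  by apply/negP => /andP[/and3P[_ _]]; rewrite eqxx.
- case/and3P: (h) => /and3P[_ vn un] lt_uv _.
  rewrite (negbTE un) h /= !andbF orbF.
  by apply/negP => /and3P[_]; rewrite ltnNge (ltnW lt_uv).
- case/and3P: h1 => _ vn un; rewrite (negbTE un) (negbTE h3) /= ltnNge.
  by rewrite (ltnW h2) /= andbF.
Qed.

Lemma cyclic_orientationP : orientation D.
Proof.
split; last exact: cyclic_orientation_asym.
move=> x y; apply/idP/idP => [xy|].
  rewrite !inE /=; case: eqVneq => //= ynx; case: (eqVneq x) => [|xny].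
    by rewrite !orbT.
  have cxy : chord x y by rewrite /chord xy ynx xny.
  rewrite (chord_sym y) cxy /=.
  case: (ltngtP (pos x) (pos y)) => [||/pos_inj E]; last 1 first.
  - by rewrite E adj_irrefl in xy.
  - by move=> _; rewrite orbF; case: (rightmost x y); rewrite ?orbT.
  - by move=> _; case: (rightmost y x); rewrite ?orbT.
have DA u v : (u, v) \in D -> adj u v.
  rewrite inE /= => /or3P[/eqP->|/and3P[/and3P[]]|/and3P[/and3P[]]] //.
  by rewrite adj_next.
by case/orP=> /DA //; rewrite adj_sym.
Qed.

(** The predecessor on the cycle is a neighbour but not an out-neighbour. *)
Lemma cyclic_outdegree_lt_degree v : outdegree D v < degree v.
Proof.
apply: proper_card; apply/properP; split.
  apply/fintype.subsetP => u; rewrite !inE => h.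
  by case: cyclic_orientationP => -> _; rewrite inE h.
have pv : next c (prev c v) = v by rewrite next_prev.
exists (prev c v); first by rewrite inE adj_sym -{2}pv adj_next.
rewrite inE; apply: cyclic_orientation_asym.
by rewrite inE /= pv eqxx.
Qed.

(* Otherwise a longer chord leftward from u and a longer chord rightward from v
   would cross each other. *)
Lemma arc_leftmost u v : theta_free G -> bipartite G ->
  chord u v -> pos v < pos u -> ~~ rightmost v u -> leftmost u v.
Proof.
move=> tG bG uv lt_vu.
rewrite /leftmost /rightmost (chord_sym v) uv lt_vu /=.
move=> /forallPn[w]; rewrite negb_imply -ltnNge => /andP[vw lt_uw].
apply/forallP => z; apply/implyP => uz; rewrite leqNgt; apply/negP => lt_zv.
apply: (chords_noncrossing tG bG lt_zv lt_vu lt_uw).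
  by rewrite adj_sym; case/and3P: uz.
by case/and3P: vw.
Qed.

Lemma cyclic_outdegree_le3 v : theta_free G -> bipartite G ->
  outdegree D v <= 3.
Proof.
move=> tG bG.
pose A := [set u | rightmost v u]; pose B := [set u | leftmost v u].
have A1 : #|A| <= 1.
  apply/card_le1_eqP => x y; rewrite !inE.
  move=> /and3P[vx _ /forallP hx] /and3P[vy _ /forallP hy].
  apply/pos_inj/eqP; rewrite eqn_leq.
  by rewrite (implyP (hx y)) // (implyP (hy x)).
have B1 : #|B| <= 1.
  apply/card_le1_eqP => x y; rewrite !inE.
  move=> /and3P[vx _ /forallP hx] /and3P[vy _ /forallP hy].
  apply/pos_inj/eqP; rewrite eqn_leq.
  by rewrite (implyP (hx y)) // (implyP (hy x)).
have sub : [set u | (v, u) \in D] \subset next c v |: (A :|: B).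
  apply/fintype.subsetP => u; rewrite !inE /=.
  case/or3P=> [->//|->|/and3P[h1 h2 h3]]; first by rewrite orbT.
  by rewrite (arc_leftmost tG bG h1 h2 h3) !orbT.
apply: leq_trans (subset_leq_card sub) _.
rewrite cardsU1; apply: (leq_add (leq_b1 _)).
by apply: leq_trans (leq_card_setU A B) _; exact: (leq_add A1 B1).
Qed.

End CyclicOrientation.

(** * Drawings *)

Section DrawingTheta.
Local Open Scope ring_scope.
Local Open Scope classical_set_scope.
Variables (R : realType) (G : sgraph).
Variables (pt : G -> R * R) (arc : G -> G -> set (R * R)).
Hypothesis drawing : plane_drawing pt arc.
Implicit Types (x y u v : G) (s t : seq G).

(** The drawing of the subgraph induced by s; it turns disjoint vertex lists into disjoint plane
    sets. *)
Definition span s : set (R * R) :=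
  [set p | (exists2 x, x \in s & p = pt x) \/
           (exists x y, [/\ x \in s, y \in s, adj x y & arc x y p])].

Lemma span_support s : span s `<=` drawing_support pt arc.
Proof.
move=> p [[x _ ->]|[x [y [_ _ xy h]]]]; first by left; exists x.
by right; exists x, y.
Qed.

Lemma span_sub s t : {subset s <= t} -> span s `<=` span t.
Proof.
move=> st p [[x /st xt ->]|[x [y [/st xs /st ys xy h]]]].
  by left; exists x.
by right; exists x, y.
Qed.

Lemma span_disjoint s t : (forall x, x \in s -> x \notin t) ->
  forall p, span s p -> ~ span t p.
Proof.
move=> st p [[x xs ->]|[x [y [xs ys xy h]]]].
  move=> [[z zt /(drawing_inj drawing) E]|[u [v [ut vt uv h]]]].
    by move: (st _ xs); rewrite E zt.
  have := drawing_vertex drawing uv h.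
  by move: (st _ xs) => + E; case: E => ->; rewrite ?ut ?vt.
move=> [[z zt E]|[u [v [ut vt uv h']]]].
  move: h; rewrite E => /(drawing_vertex drawing xy).
  by case=> E'; [move: (st _ xs) | move: (st _ ys)]; rewrite -E' zt.
(* The edges differ, so a common point is an end of the first; as a vertex on the second it is an
   end of that one too, against disjointness. *)
have ne : [set x; y]%SET != [set u; v]%SET.
  apply/eqP => /setP /(_ x); rewrite !inE eqxx /= => /esym/orP[] /eqP E.
    by move: (st _ xs); rewrite E ut.
  by move: (st _ xs); rewrite E vt.
have := drawing_edge drawing xy uv ne h h'.
case=> E; move: h'; rewrite E => /(drawing_vertex drawing uv) [] E'.
- by move: (st _ xs); rewrite E' ut.
- by move: (st _ xs); rewrite E' vt.
- by move: (st _ ys); rewrite E' ut.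
- by move: (st _ ys); rewrite E' vt.
Qed.

Lemma arc_linked x y : adj x y -> linked (arc x y) (pt x) (pt y).
Proof.
move=> xy; have [g [cg _ g0 g1 E]] := drawing_arc drawing xy.
exists (arc x y); rewrite E; split=> //.
- by apply: continuous_compact => //; exact: segment_compact.
- by apply: connected_continuous_connected => //; exact: segment_connected.
- by exists 0 => //; rewrite /= in_itv /= lexx ler01.
- by exists 1 => //; rewrite /= in_itv /= lexx ler01.
Qed.

Lemma path_linked x s : path (@adj G) x s ->
  linked (span (x :: s)) (pt x) (pt (last x s)).
Proof.
elim: s x => [|y s IH] x /=.
  by move=> _; apply: linked_refl; left; exists x; rewrite ?mem_head.
case/andP=> xy /IH h; apply: (@linked_trans _ _ _ (pt y)).
  apply: linked_sub (arc_linked xy) => p hp; right; exists x, y.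
  by rewrite !inE !eqxx ?orbT.
by apply: linked_sub h; apply: span_sub => z zs; rewrite inE zs orbT.
Qed.

(** K_{3,3} has the classes x, y, [f0] and the first inner vertices [a i]. [Kx i] is the first edge
    of path i, [Ky i] the rest of it, and [Kf i] runs through the face. Two sets [Kf i] and [Kf j]
    may meet, as their edges share [f0]. *)
Lemma face_theta_free F : is_face (drawing_support pt arc) F ->
  (forall x, closure F (pt x)) -> theta_free G.
Proof.
move=> [f0 f0S FE] clF x y s1 s2 s3 [us [n1 n2 n3] [p1 p2 p3]].
pose s (i : 'I_3) := nth [::] [:: s1; s2; s3] i.
have sP i : [/\ s i != [::], path (@adj G) x (rcons (s i) y),
    x \notin s i, y \notin s i &
    forall j, i != j -> forall z, z \in s i -> z \notin s j].
  move: us; rewrite !cons_uniq in_cons !mem_cat !cat_uniq has_cat !negb_or.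
  rewrite -!andbA => /and5P[_ x1 x2 x3 /and5P[y1 y2 y3 _]].
  move=> /and5P[/hasPn d12 /hasPn d13 _ /hasPn d23 _].
  have d21 z : z \in s1 -> z \notin s2 by apply: contraL => /d12.
  have d31 z : z \in s1 -> z \notin s3 by apply: contraL => /d13.
  have d32 z : z \in s2 -> z \notin s3 by apply: contraL => /d23.
  rewrite /s; case: i => [[|[|[|//]]] ?] /=; split=> //;
    by case=> [[|[|[|//]]] ?] //= _ z; auto.
(* The default x is never taken, the paths having nonempty interior. *)
pose a i := head x (s i).
have aP i : a i \in s i.
  rewrite /a; have [] := sP i; case: (s i) => // b r _ _ _ _ _.
  exact: mem_head.
have xy : x != y.
  by move: us; rewrite cons_uniq in_cons negb_or -andbA => /andP[].
have /choice[Kx KxP] i : exists K, [/\ compact K, connected K,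
    K (pt x), K (pt (a i)) & K `<=` span [:: x; a i]].
  apply: (@path_linked x [:: a i]) => /=; rewrite andbT.
  by rewrite /a; have [] := sP i; case: (s i) => //= b r _ /andP[].
have /choice[Ky KyP] i : exists K, [/\ compact K, connected K,
    K (pt y), K (pt (a i)) & K `<=` span (y :: s i)].
  apply: linked_sym; have [si0 + _ _ _] := sP i.
  rewrite /a; case: (s i) si0 => //= b r _ /andP[_] /path_linked.
  rewrite last_rcons; apply: linked_sub; apply: span_sub => z.
  by rewrite !(inE, mem_rcons) orbCA.
have dxa i j : i != j -> forall z, z \in [:: x; a i] -> z \notin y :: s j.
  move=> ij z; rewrite !inE negb_or => /orP[]/eqP->.
    by rewrite xy; have [] := sP j.
  have [_ _ _ yi dij] := sP i; rewrite (dij _ ij _ (aP i)) andbT.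
  by apply: contraNneq yi => <-.
(* An open set around the face and [pt (a i)] that avoids the other two paths. *)
pose Z i : set (R * R) := ~` \bigcup_(j in [set j | j != i]) (Kx j `|` Ky j).
have oZ i : open (Z i).
  apply: closed_openC; apply: closed_bigcup; first exact: finite_finset.
  move=> j _; apply: compact_closed; first exact: norm_hausdorff.
  by apply: compactU; [case: (KxP j) | case: (KyP j)].
have FZ i : F `<=` Z i.
  move=> p Fp [j _ h].
  have : drawing_support pt arc p.
    case: h => h; [have [_ _ _ _ hs] := KxP j | have [_ _ _ _ hs] := KyP j];
    exact: span_support (hs _ h).
  by move: Fp; rewrite FE => /connected_component_sub.
have aZ i : Z i (pt (a i)).
  move=> [j /= ji h]; have ij : i != j by rewrite eq_sym.
  have ha : span [:: a i] (pt (a i)) by left; exists (a i); rewrite ?mem_head.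
  have [_ _ xi yi dij] := sP i.
  case: h => h.
    have [_ _ _ _ hs] := KxP j; apply: span_disjoint ha (hs _ h) => z.
    rewrite inE => /eqP->; rewrite !inE negb_or; apply/andP; split.
      by apply: contraNneq xi => <-.
    by apply: contraTneq (aP j) => <-; exact: dij.
  have [_ _ _ _ hs] := KyP j; apply: span_disjoint ha (hs _ h) => z.
  rewrite inE => /eqP->; apply: (dxa _ _ ij).
  by rewrite !inE eqxx orbT.
have Ff0 : F f0 by rewrite FE; exact: connected_component_refl.
have /choice[Kf KfP] i : exists K, [/\ compact K, connected K,
    K f0, K (pt (a i)) & K `<=` Z i].
  have : nbhs (pt (a i)) (Z i) by apply: open_nbhs_nbhs; split.
  rewrite -nbhs_ballE => -[r /= r0 rZ].
  (* From [f0] to q inside the face, then along a straight segment to [pt (a i)], within a ball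
     contained in [Z i]. *)
  have [q [Fq qr]] := clF (a i) _ (nbhsx_ballx _ _ r0).
  apply: (@linked_trans _ _ _ q).
    apply: (linked_open (oZ i) _ (FZ i)) => //.
    by rewrite FE; exact: component_connected.
  apply: linked_sym; apply: (@linked_segment _ r).
    by move=> z az; apply: rZ; rewrite closeE.
  by rewrite -closeE.
apply: (@K33_not_planar R (fun i : 'I_3 => nth f0 [:: pt x; pt y; f0] i)
  (fun i => pt (a i)) (fun i => nth Kf [:: Kx; Ky; Kf] i)).
  case=> [[|[|[|//]]] ?] j /=;
    [have [] := KxP j | have [] := KyP j | have [] := KfP j];
  by move=> *; split.
have Dxy i j z : i != j -> Kx i z -> ~ Ky j z.
  move=> ij h h'; have [_ _ _ _ hs] := KxP i; have [_ _ _ _ hs'] := KyP j.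
  exact: (span_disjoint (dxa _ _ ij) (hs _ h) (hs' _ h')).
have Dxf i j z : i != j -> Kx i z -> ~ Kf j z.
  move=> ij h h'; have [_ _ _ _ hs] := KfP j.
  by apply: (hs _ h'); exists i => //; left.
have Dyf i j z : i != j -> Ky i z -> ~ Kf j z.
  move=> ij h h'; have [_ _ _ _ hs] := KfP j.
  by apply: (hs _ h'); exists i => //; right.
case=> [[|[|[|//]]] ?] [[|[|[|//]]] ?] j j' //= _ jj' z h h';
  have jj : j' != j by rewrite eq_sym.
- exact: Dxy jj' h h'.
- exact: Dxf jj' h h'.
- exact: Dxy jj h' h.
- exact: Dyf jj' h h'.
- exact: Dxf jj h' h.
- exact: Dyf jj h' h.
Qed.

End DrawingTheta.

Theorem theorem1p4 (R : realType) (G : sgraph) :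
  k_connected G 2 -> bipartite G -> outerplanar R G ->
  truncated_degree_AT G 4.
Proof.
move=> kG bG [pt [arc [F [drawing faceF _ clF]]]].
have tG : theta_free G := face_theta_free drawing faceF clF.
have [c cc c_all] := hamiltonian kG tG.
have c3 : 2 < size c.
  case: kG => G3 _; apply: leq_trans G3 _; rewrite cardE.
  by apply: uniq_leq_size (enum_uniq _) _ => v _.
exists (cyclic_orientation c).
  exact/bipartite_AT_orientation/cyclic_orientationP.
move=> v; rewrite leq_min ltnS cyclic_outdegree_le3 //.
exact: cyclic_outdegree_lt_degree.
Qed.
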